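(* Let $\mathcal{S},\mathcal{T}$ be b0-spaces, let $f\colon\mathcal{S}\to\mathcal{T}$ be a basic continuous map and let $f_{\leftarrow}\colon\mathcal{B}d(\mathcal{T})\to\mathcal{B}d(\mathcal{S})$ be its basic preimage. Then $f_{\leftarrow}$ is a coframe homomorphism, i.e. it preserves arbitrary meets and finite joins (including the bottom element).
   Context: A closure system on a set $X$ is a family of subsets of $X$ containing $X$ and closed under arbitrary intersections; ordered by inclusion it is a complete lattice whose meets are intersections and whose joins $\vee$ are the least members containing the union. A basic zero-dimensional space (b0-space) is a triple $\mathcal{S}=(X,\mathcal{C},\mathcal{B}d)$ where $X$ is a set, $\mathcal{B}d$ is a closure system on $X$ that is distributive as a lattice, and $\mathcal{C}\subseteq\mathcal{B}d$ is such that every $C\in\mathcal{C}$ has a complement $\neg C$ in the lattice $\mathcal{B}d$, and every $M\in\mathcal{B}d$ is of the form $M=\bigcap_{i\in J}(C_i^1\vee\neg D_i^1\vee\dots\vee C_i^{n_i}\vee\neg D_i^{n_i})$ with all $C_i^k,D_i^k\in\mathcal{C}$ (finite joins in $\mathcal{B}d$, the empty join being allowed). Write $|\mathcal{S}|=X$, $\mathcal{C}(\mathcal{S})=\mathcal{C}$, $\mathcal{B}d(\mathcal{S})=\mathcal{B}d$; the bottom element of $\mathcal{B}d$ is denoted $\mathsf{O}$ (same symbol for every b0-space). The lattice $\mathcal{B}d(\mathcal{S})$ is always a coframe. A basic continuous map $f\colon\mathcal{S}\to\mathcal{T}$ between b0-spaces is a map $f\colon|\mathcal{S}|\to|\mathcal{T}|$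 such that: (BC1) $f^{-1}[\mathsf{O}]=\mathsf{O}$; (BC2) there is a map $f_{\leftarrow}^{\mathfrak{c}}\colon\mathcal{C}(\mathcal{T})\to\mathcal{C}(\mathcal{S})$ such that $f[B]\subseteq C$ iff $B\subseteq f_{\leftarrow}^{\mathfrak{c}}[C]$ for all $B\in\mathcal{C}(\mathcal{S})$, $C\in\mathcal{C}(\mathcal{T})$ (this map is then unique); (BC3) $\neg f_{\leftarrow}^{\mathfrak{c}}[C]\subseteq f^{-1}[\neg C]$ for all $C\in\mathcal{C}(\mathcal{T})$; (BC4) $\bigvee_{i=1}^n(f_{\leftarrow}^{\mathfrak{c}}[C_i]\vee\neg f_{\leftarrow}^{\mathfrak{c}}[D_i])\subseteq f^{-1}[\bigvee_{i=1}^n(C_i\vee\neg D_i)]$ for all $n$ and all $C_i,D_i\in\mathcal{C}(\mathcal{T})$. For a basic continuous $f$, the basic image is $f_{\rightarrow}\colon\mathcal{B}d(\mathcal{S})\to\mathcal{B}d(\mathcal{T})$, $f_{\rightarrow}[M]=\bigcap\{S\in\mathcal{B}d(\mathcal{T})\mid f[M]\subseteq S\}$; it has a right adjoint $f_{\leftarrow}\colon\mathcal{B}d(\mathcal{T})\to\mathcal{B}d(\mathcal{S})$ (so $f_{\rightarrow}[M]\subseteq K$ iff $M\subseteq f_{\leftarrow}[K]$), called the basic preimage of $f$. *)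

(* Defs.v *)
From mathcomp Require Import all_boot.
From mathcomp Require Import boolp classical_sets.

Set Implicit Arguments.
Unset Strict Implicit.
Unset Printing Implicit Defensive.

Local Open Scope classical_set_scope.

Section ClosureSystem.
Variable X : Type.
Implicit Types (Bd : set (set X)) (A B C N : set X).

Definition closure_system Bd : Prop :=
  Bd setT /\ forall F : set (set X), F `<=` Bd -> Bd (\bigcap_(M in F) M).

(* The least member of Bd containing A; joins in Bd are closures of unions. *)
Definition cl Bd A : set X := \bigcap_(M in [set M | Bd M /\ A `<=` M]) M.

Definition bot Bd : set X := \bigcap_(M in Bd) M.

Definition join Bd A B : set X := cl Bd (A `|` B).

(* For n = 0 this is cl Bd set0 = bot Bd. *)
Definition fjoin Bd (n : nat) (A : 'I_n -> set X) : set X :=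
  cl Bd (\bigcup_(i in [set: 'I_n]) A i).

Definition distributive_lattice Bd : Prop :=
  forall A B C, Bd A -> Bd B -> Bd C ->
    A `&` join Bd B C = join Bd (A `&` B) (A `&` C).

Definition is_complement Bd C N : Prop :=
  [/\ Bd N, C `&` N = bot Bd & join Bd C N = setT].

(* The complement of C in Bd, which is unique when Bd is distributive;
   a junk value if C has no complement. *)
Definition neg Bd C : set X := xget set0 [set N | is_complement Bd C N].

(* The joins C_1 v ~D_1 v ... v C_n v ~D_n with all C_k, D_k in Cs. *)
Definition basic_term (Cs Bd : set (set X)) : set (set X) :=
  [set A | exists (n : nat) (C D : 'I_n -> set X),
    [/\ forall k, Cs (C k), forall k, Cs (D k)
      & A = fjoin Bd (fun k => join Bd (C k) (neg Bd (D k)))]].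

End ClosureSystem.

Record b0space := B0Space {
  carrier :> Type;
  Cset : set (set carrier);
  Bdset : set (set carrier);
  b0_closure_system : closure_system Bdset;
  b0_distributive : distributive_lattice Bdset;
  b0_sub : Cset `<=` Bdset;
  b0_complement : forall C, Cset C -> exists N, is_complement Bdset C N;
  b0_generated : forall M, Bdset M ->
    exists2 F, F `<=` basic_term Cset Bdset & M = \bigcap_(A in F) A
}.

Arguments Cset : clear implicits.
Arguments Bdset : clear implicits.

Section BasicContinuous.
Variables S T : b0space.
Implicit Types (f : S -> T) (g : set T -> set S).

(* Maps between families of subsets are encoded as total functions on all
   subsets, of which only the values on the family are constrained. *)

Definition BC1 f : Prop := f @^-1` bot (Bdset T) = bot (Bdset S).

Definition BC2 f g : Prop :=
  (forall C, Cset T C -> Cset S (g C)) /\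
  (forall B C, Cset S B -> Cset T C -> (f @` B `<=` C <-> B `<=` g C)).

Definition BC3 f g : Prop :=
  forall C, Cset T C ->
    neg (Bdset S) (g C) `<=` f @^-1` neg (Bdset T) C.

Definition BC4 f g : Prop :=
  forall (n : nat) (C D : 'I_n -> set T),
    (forall i, Cset T (C i)) -> (forall i, Cset T (D i)) ->
    fjoin (Bdset S) (fun i => join (Bdset S) (g (C i)) (neg (Bdset S) (g (D i))))
    `<=` f @^-1`
      fjoin (Bdset T) (fun i => join (Bdset T) (C i) (neg (Bdset T) (D i))).

(* BC2 determines g on Cset T, so one g may be shared by BC2, BC3 and BC4. *)
Definition basic_continuous f : Prop :=
  BC1 f /\ exists g, [/\ BC2 f g, BC3 f g & BC4 f g].

Definition basic_image f (M : set S) : set T := cl (Bdset T) (f @` M).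

Definition is_basic_preimage f g : Prop :=
  (forall K, Bdset T K -> Bdset S (g K)) /\
  (forall M K, Bdset S M -> Bdset T K ->
    (basic_image f M `<=` K <-> M `<=` g K)).

End BasicContinuous.

(* The meet clause includes the empty family (top element). *)
Definition coframe_hom (X Y : Type) (BX : set (set X)) (BY : set (set Y))
    (g : set X -> set Y) : Prop :=
  [/\ forall K, BX K -> BY (g K),
      forall F : set (set X), F `<=` BX ->
        g (\bigcap_(K in F) K) = \bigcap_(K in F) g K,
      g (bot BX) = bot BY
    & forall (n : nat) (K : 'I_n -> set X), (forall i, BX (K i)) ->
        g (fjoin BX K) = fjoin BY (fun i => g (K i))].

(* Main.v *)
Require Import Defs.
From mathcomp Require Import all_boot.
From mathcomp Require Import boolp classical_sets.

(** Being a right adjoint, the basic preimage [g] preserves all meets, and (BC1)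
    gives the bottom element; the point is that
    [g (K v L) <= g K v g L].

    Say that [g] splits [K] when some [N] satisfies [K /\ N = O] and
    [g K v g N = 1].  Then [g] preserves every join with [K] ([split_join_sub]):
    [g (K v L) /\ g N = g ((K v L) /\ N) <= g L], so cutting [g (K v L)] along
    [g K v g N = 1] leaves only [g K v g L].  Every [C] in [C(T)] is split, with
    [N = ~C]: (BC2) and (BC3) put [h C] below [g C] and [~h C] below [g (~C)],
    where [h] is the map on [C(T)] given by (BC2).  Split elements are closed
    under swapping [K] with [N] and under finite joins, hence all the basic terms
    [C_1 v ~D_1 v ... v C_n v ~D_n] are split ([split_basic_term]).

    An arbitrary [K] is a meet of basic terms [A], so
    [g (K v L) <= /\_A g (A v L) <= /\_A (g A v g L)].  It remains to pull the
    join with [g L] out of the meet, which is the coframe law of [Bd(S)]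
    ([b0_coframe]).  That law holds because every element is a meet of
    complemented ones, and complemented means split by the identity map. *)

Set Implicit Arguments.
Unset Strict Implicit.
Unset Printing Implicit Defensive.

Local Open Scope classical_set_scope.

(** * Joins in a closure system *)

Section ClosureSystemTheory.
Variables (X : Type) (Bd : set (set X)).
Hypothesis hBd : closure_system Bd.
Implicit Types A B K L M N : set X.

Lemma closed_setT : Bd setT.
Proof. by case: hBd. Qed.

Lemma closed_setI A B : Bd A -> Bd B -> Bd (A `&` B).
Proof.
move=> hA hB; have -> : A `&` B = \bigcap_(M in [set A; B]) M.
  by rewrite bigcap_setU !bigcap_set1.
by apply: hBd.2 => M [] ->.
Qed.

Lemma closed_cl A : Bd (cl Bd A).
Proof. by apply: hBd.2 => M []. Qed.

Lemma closed_bot : Bd (bot Bd).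
Proof. exact: hBd.2. Qed.

Lemma closed_join A B : Bd (join Bd A B).
Proof. exact: closed_cl. Qed.

Lemma closed_fjoin n (A : 'I_n -> set X) : Bd (fjoin Bd A).
Proof. exact: closed_cl. Qed.

Lemma sub_cl A : A `<=` cl Bd A.
Proof. by move=> x Ax M [_]; apply. Qed.

Lemma cl_min A M : Bd M -> A `<=` M -> cl Bd A `<=` M.
Proof. by move=> hM AM x; apply. Qed.

Lemma bot_sub M : Bd M -> bot Bd `<=` M.
Proof. by move=> hM x; apply. Qed.

Lemma sub_joinl A B : A `<=` join Bd A B.
Proof. by move=> x Ax; apply: sub_cl; left. Qed.

Lemma sub_joinr A B : B `<=` join Bd A B.
Proof. by move=> x Bx; apply: sub_cl; right. Qed.

Lemma join_min A B M : Bd M -> A `<=` M -> B `<=` M -> join Bd A B `<=` M.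
Proof. by move=> hM AM BM; apply: cl_min => // x [/AM|/BM]. Qed.

Lemma joinC A B : join Bd A B = join Bd B A.
Proof. by rewrite /join setUC. Qed.

Lemma sub_fjoin n (A : 'I_n -> set X) i : A i `<=` fjoin Bd A.
Proof. by move=> x Ax; apply: sub_cl; exists i. Qed.

Lemma fjoin_min n (A : 'I_n -> set X) M :
  Bd M -> (forall i, A i `<=` M) -> fjoin Bd A `<=` M.
Proof. by move=> hM AM; apply: cl_min => // x [i _ /AM]. Qed.

Lemma fjoin0 (A : 'I_0 -> set X) : fjoin Bd A = bot Bd.
Proof.
apply/seteqP; split; first by apply: fjoin_min; [exact: closed_bot|case].
by apply: bot_sub; exact: closed_fjoin.
Qed.

Lemma fjoin_recl n (A : 'I_n.+1 -> set X) :
  fjoin Bd A = join Bd (A ord0) (fjoin Bd (fun i => A (lift ord0 i))).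
Proof.
apply/seteqP; split.
  apply: fjoin_min; first exact: closed_join.
  move=> i; case: (unliftP ord0 i) => [j ->|->]; last exact: sub_joinl.
  exact: subset_trans (sub_fjoin (A := fun i => A (lift ord0 i)) (i := j))
    (@sub_joinr _ _).
apply: join_min; [exact: closed_fjoin|exact: sub_fjoin|].
by apply: fjoin_min => [|i]; [exact: closed_fjoin|exact: sub_fjoin].
Qed.

Hypothesis hD : distributive_lattice Bd.

Lemma join_disjoint_sub K L N : Bd K -> Bd L -> Bd N ->
  K `&` N = bot Bd -> join Bd K L `&` N `<=` L.
Proof.
move=> hK hL hN KN; rewrite setIC hD//; apply: join_min => //.
by rewrite setIC KN; exact: bot_sub.
Qed.

(** The cut rule: a lattice form of reasoning by cases on [K v N = 1]. *)
Lemma sub_join_cut K L M N : Bd K -> Bd M -> Bd N ->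
  join Bd K N = setT -> M `&` N `<=` L -> M `<=` join Bd K L.
Proof.
move=> hK hM hN KN MN; rewrite -[M]setIT -KN hD//.
apply: join_min; first exact: closed_join.
- exact: subset_trans (@subIsetr _ _ _) (@sub_joinl _ _).
- exact: subset_trans MN (@sub_joinr _ _).
Qed.

End ClosureSystemTheory.

(** * Elements split by a meet-preserving map *)

Section Split.
Variables (X Y : Type) (BX : set (set X)) (BY : set (set Y)).
Variable g : set X -> set Y.

(** Weaker than asking [N] to be a complement of [K] whose image is a complement
    of [g K]; for [g = id] this is exactly being complemented. *)
Definition split K := exists N,
  [/\ BX K, BX N, K `&` N = bot BX & join BY (g K) (g N) = setT].

Lemma split_closed K : split K -> BX K.
Proof. by case=> N []. Qed.

Hypothesis hX : closure_system BX.
Hypothesis hY : closure_system BY.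
Hypothesis dX : distributive_lattice BX.
Hypothesis dY : distributive_lattice BY.
Hypothesis gBd : forall K, BX K -> BY (g K).
Hypothesis g_bigcap : forall F, F `<=` BX ->
  g (\bigcap_(K in F) K) = \bigcap_(K in F) g K.

Lemma meet_hom_setT : g setT = setT.
Proof.
by have := @g_bigcap set0 (@sub0set _ _); rewrite !bigcap_set0.
Qed.

Lemma meet_hom_setI K L : BX K -> BX L -> g (K `&` L) = g K `&` g L.
Proof.
move=> hK hL; have := @g_bigcap [set K; L].
by rewrite !bigcap_setU !bigcap_set1; apply=> M [] ->.
Qed.

Lemma meet_hom_sub K L : BX K -> BX L -> K `<=` L -> g K `<=` g L.
Proof. by move=> hK hL /setIidPl {1}<-; rewrite meet_hom_setI. Qed.

Lemma split_bot : split (bot BX).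
Proof.
exists setT; split; [exact: closed_bot|exact: closed_setT|exact: setIT|].
by rewrite meet_hom_setT; apply/seteqP; split=> // x _; exact: sub_joinr.
Qed.

Lemma split_join K L : split K -> split L -> split (join BX K L).
Proof.
move=> [N [hK hN KN gKN]] [P [hL hP LP gLP]].
have hKL : BX (join BX K L) by exact: closed_join.
have hNP : BX (N `&` P) by exact: closed_setI.
exists (N `&` P); split => //.
  apply/seteqP; split; last by apply: bot_sub; exact: closed_setI.
  rewrite -LP => x [KLx [Nx Px]]; split=> //.
  exact: (join_disjoint_sub dX hK hL hN KN).
have hJ : BY (join BY (g (join BX K L)) (g (N `&` P))) by exact: closed_join.
have gKle : g K `<=` g (join BX K L).
  by apply: meet_hom_sub => //; exact: sub_joinl.
have gLle : g L `<=` g (join BX K L).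
  by apply: meet_hom_sub => //; exact: sub_joinr.
apply/seteqP; split=> //.
(* The top is [g K v g N]; inside [g N], cutting along [g L v g P = 1] leaves
   [g N /\ g P = g (N /\ P)]. *)
have gNle : g N `<=` join BY (g (join BX K L)) (g (N `&` P)).
  apply: subset_trans (join_min hJ _ (@subset_refl _ _)).
    apply: (sub_join_cut hY dY (gBd hL) (gBd hN) (gBd hP) gLP).
    rewrite -meet_hom_setI//; exact: sub_joinr.
  exact: subset_trans gLle (@sub_joinl _ _ _ _).
rewrite -{1}gKN; apply: join_min => //.
exact: subset_trans gKle (@sub_joinl _ _ _ _).
Qed.

Lemma split_fjoin n (A : 'I_n -> set X) :
  (forall i, split (A i)) -> split (fjoin BX A).
Proof.
elim: n A => [|n IH] A hA; first by rewrite fjoin0//; exact: split_bot.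
by rewrite fjoin_recl//; apply: split_join => //; apply: IH.
Qed.

Lemma split_basic_term (Cs : set (set X)) :
  (forall C, Cs C -> split C) -> (forall C, Cs C -> split (neg BX C)) ->
  basic_term Cs BX `<=` split.
Proof.
move=> hC hN A [n [C [D [CsC CsD ->]]]].
by apply: split_fjoin => i; apply: split_join; [exact: hC|exact: hN].
Qed.

Lemma split_join_sub K L : split K -> BX L ->
  g (join BX K L) `<=` join BY (g K) (g L).
Proof.
move=> [N [hK hN KN gKN]] hL.
have hKL : BX (join BX K L) by exact: closed_join.
apply: (sub_join_cut hY dY (gBd hK) (gBd hKL) (gBd hN) gKN).
rewrite -meet_hom_setI//; apply: meet_hom_sub => //; first exact: closed_setI.
exact: (join_disjoint_sub dX hK hL hN KN).
Qed.

End Split.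

(** * The coframe law *)

Lemma negP (S : b0space) (C : set S) :
  Cset S C -> is_complement (Bdset S) C (neg (Bdset S) C).
Proof. by move=> /b0_complement; exact: xgetPex. Qed.

Lemma basic_term_complemented (S : b0space) (A : set S) :
  basic_term (Cset S) (Bdset S) A -> split (Bdset S) (Bdset S) id A.
Proof.
apply: split_basic_term => //.
- exact: b0_closure_system.
- exact: b0_closure_system.
- exact: b0_distributive.
- exact: b0_distributive.
- move=> C CsC; have [hN CN CvN] := negP CsC.
  by exists (neg (Bdset S) C); split => //; exact: b0_sub.
- move=> C CsC; have [hN CN CvN] := negP CsC.
  exists C; split => //; first exact: b0_sub.
    by rewrite setIC.
  by rewrite joinC.
Qed.

(** The inclusion can be tested on the complemented [E] containing the right-hand
    side, since that side is a meet of such [E].  For these, a cut along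
    [E v N = 1] works because [(Q i v L) /\ N <= Q i] for each [i]. *)
Lemma b0_coframe (S : b0space) (I : Type) (F : set I) (Q : I -> set S)
    (L : set S) :
  (forall i, F i -> Bdset S (Q i)) -> Bdset S L ->
  \bigcap_(i in F) join (Bdset S) (Q i) L
    `<=` join (Bdset S) (\bigcap_(i in F) Q i) L.
Proof.
set Bd := Bdset S => hQ hL.
have hS : closure_system Bd by exact: b0_closure_system.
have dS : distributive_lattice Bd by exact: b0_distributive.
set W := join Bd (\bigcap_(i in F) Q i) L.
have [G Gterm WE] : exists2 G, G `<=` basic_term (Cset S) Bd
    & W = \bigcap_(A in G) A by apply: b0_generated; exact: closed_join.
rewrite WE => x xM E GE.
have WsubE : W `<=` E by rewrite WE => y; apply.
have [N [hE hN EN EvN]] := basic_term_complemented (Gterm E GE).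
set M := \bigcap_(i in F) join Bd (Q i) L in xM.
have hM : Bd M.
  have -> : M = \bigcap_(A in [set join Bd (Q i) L | i in F]) A.
    by rewrite bigcap_image.
  by apply: hS.2 => _ [i _ <-]; exact: closed_join.
(* [E v E] is only there to give the cut its shape: [E] is its own join. *)
suff MEE : M `<=` join Bd E E.
  by apply: (join_min hE (@subset_refl _ E) (@subset_refl _ E)); exact: MEE.
apply: (sub_join_cut hS dS hE hM hN EvN).
apply: (subset_trans _ WsubE); apply: subset_trans (@sub_joinl _ _ _ _).
move=> y [yM yN] i Fi.
have QLsub : join Bd (Q i) L `<=` join Bd E (Q i).
  apply: join_min; [exact: closed_join|exact: sub_joinr|].
  apply: subset_trans (@sub_joinl _ _ _ _).
  exact: subset_trans (@sub_joinr _ _ _ _) WsubE.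
apply: (join_disjoint_sub dS hE (hQ i Fi) hN EN).
by split=> //; apply: QLsub; exact: yM.
Qed.

(** * The basic preimage *)

Section BasicPreimage.
Variables (S T : b0space) (f : S -> T) (fpre : set T -> set S).
Hypothesis hfpre : is_basic_preimage f fpre.

Lemma sub_basic_preimage M K : Bdset S M -> Bdset T K ->
  M `<=` fpre K <-> M `<=` f @^-1` K.
Proof.
move=> hM hK; rewrite -(hfpre.2 M K hM hK); split.
- move=> imMK x Mx; apply: imMK; apply: sub_cl; exact: imageP.
- by move=> MK; apply: cl_min => // _ [x Mx <-]; exact: MK.
Qed.

Lemma basic_preimage_sub K : Bdset T K -> fpre K `<=` f @^-1` K.
Proof.
by move=> hK; apply/sub_basic_preimage => //; exact: hfpre.1.
Qed.

Lemma basic_preimage_bigcap (F : set (set T)) : F `<=` Bdset T ->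
  fpre (\bigcap_(K in F) K) = \bigcap_(K in F) fpre K.
Proof.
move=> hF.
have hcapT : Bdset T (\bigcap_(K in F) K) by apply: (b0_closure_system T).2.
have hcapS : Bdset S (\bigcap_(K in F) fpre K).
  rewrite -(bigcap_image F fpre id).
  by apply: (b0_closure_system S).2 => _ [K /hF hK <-]; exact: hfpre.1.
apply/seteqP; split.
- move=> x gx K FK; have hK := hF _ FK; move: x gx.
  apply/sub_basic_preimage => //; first exact: hfpre.1.
  by move=> x /(basic_preimage_sub hcapT); apply.
- apply/sub_basic_preimage => // x gx K FK.
  by apply: (basic_preimage_sub (hF _ FK)); exact: gx.
Qed.

Hypothesis hf : basic_continuous f.

Lemma basic_preimage_bot : fpre (bot (Bdset T)) = bot (Bdset S).
Proof.
have hb : Bdset T (bot (Bdset T)) by apply: closed_bot; exact: b0_closure_system.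
apply/seteqP; split; first by rewrite -hf.1; exact: basic_preimage_sub.
by apply: bot_sub; exact: hfpre.1.
Qed.

Lemma basic_preimage_join_neg C : Cset T C ->
  join (Bdset S) (fpre C) (fpre (neg (Bdset T) C)) = setT.
Proof.
move=> CsC; have [_ [h [[hCs hadj] hneg _]]] := hf.
have hC := b0_sub CsC; have [hN _ _] := negP CsC.
have [hhN _ hCvN] := negP (hCs C CsC).
apply/seteqP; split=> //; rewrite -hCvN.
apply: join_min; first by apply: closed_join; exact: b0_closure_system.
- apply: subset_trans (@sub_joinl _ _ _ _).
  apply/sub_basic_preimage => //; first exact/b0_sub/hCs.
  move=> x hCx; have fhC : f @` h C `<=` C by apply/hadj => //; exact: hCs.
  by apply: fhC; exact: imageP.
- apply: subset_trans (@sub_joinr _ _ _ _).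
  by apply/sub_basic_preimage => //; exact: hneg.
Qed.

Lemma basic_preimage_split_term :
  basic_term (Cset T) (Bdset T) `<=` split (Bdset T) (Bdset S) fpre.
Proof.
apply: split_basic_term.
- exact: b0_closure_system.
- exact: b0_closure_system.
- exact: b0_distributive.
- exact: b0_distributive.
- exact: hfpre.1.
- exact: basic_preimage_bigcap.
- move=> C CsC; have [hN CN _] := negP CsC.
  exists (neg (Bdset T) C); split => //; first exact: b0_sub.
  exact: basic_preimage_join_neg.
- move=> C CsC; have [hN CN _] := negP CsC.
  exists C; split => //; first exact: b0_sub.
    by rewrite setIC.
  by rewrite joinC; exact: basic_preimage_join_neg.
Qed.

Lemma basic_preimage_join K L : Bdset T K -> Bdset T L ->
  fpre (join (Bdset T) K L) = join (Bdset S) (fpre K) (fpre L).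
Proof.
move=> hK hL.
have hT := b0_closure_system T; have hS := b0_closure_system S.
have dT := @b0_distributive T; have dS := @b0_distributive S.
have mono := meet_hom_sub basic_preimage_bigcap.
have hKL : Bdset T (join (Bdset T) K L) by exact: closed_join.
apply/seteqP; split; last first.
  apply: join_min; first exact: hfpre.1.
  - by apply: mono => //; exact: sub_joinl.
  - by apply: mono => //; exact: sub_joinr.
have [F Fterm KE] := b0_generated hK.
have Fsplit A : F A -> split (Bdset T) (Bdset S) fpre A.
  by move=> /Fterm; exact: basic_preimage_split_term.
have FBd : F `<=` Bdset T by move=> A /Fsplit/split_closed.
rewrite [in fpre K]KE basic_preimage_bigcap//.
apply: subset_trans (b0_coframe (F := F) (Q := fpre) _ (hfpre.1 _ hL)); last first.
  by move=> A /FBd; exact: hfpre.1.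
move=> x gx A FA.
have hA := FBd _ FA.
have hAL : Bdset T (join (Bdset T) A L) by exact: closed_join.
apply: (split_join_sub hT hS dT dS hfpre.1 basic_preimage_bigcap (Fsplit A FA) hL).
move: x gx; apply: mono => //.
apply: join_min => //; last exact: sub_joinr.
by apply: subset_trans (@sub_joinl _ _ _ _); rewrite KE => x; apply.
Qed.

End BasicPreimage.

Theorem theorem6p1 (S T : b0space) (f : S -> T) (hf : basic_continuous f)
    (fpre : set T -> set S) (hfpre : is_basic_preimage f fpre) :
  coframe_hom (Bdset T) (Bdset S) fpre.
Proof.
have hT := b0_closure_system T; have hS := b0_closure_system S.
split; [exact: hfpre.1|exact: (basic_preimage_bigcap hfpre)|
  exact: (basic_preimage_bot hfpre hf)|].
elim=> [|n IH] K hK.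
  by rewrite !fjoin0//; exact: (basic_preimage_bot hfpre hf).
rewrite !fjoin_recl// (basic_preimage_join hfpre hf)//; last exact: closed_fjoin.
by rewrite IH.
Qed.
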